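(* There exists $n_0$ such that for every even integer $n\ge n_0$ there exists a coupling of $2S_n$ and $S_{4n}$ such that (almost surely) they have the same sign, meaning $S_nS_{4n}\ge 0$, and $$|S_{4n}|-\frac{1}{8n}|S_{4n}|^2-9\;\le\;2|S_n|\;\le\;|S_{4n}|+2.$$
   Context: For each $N\ge 1$, $S_N$ denotes a random variable distributed as $X_1+\ldots+X_N$ where $X_i$ are i.i.d. with $X_i=\pm1$ with probability $1/2$ each. A coupling of random variables $X,Y$ satisfying certain statements means a probability space carrying random variables with the same marginal distributions as $X$ and $Y$ respectively and satisfying the stated mutual relationships (so in the coupling, only the marginal laws of $S_n$ and $S_{4n}$ are prescribed). *)

(* Defs.v *)
From HB Require Import structures.
From mathcomp Require Import all_boot all_order all_algebra.
From mathcomp Require Import all_classical all_reals all_analysis.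

Set Implicit Arguments.
Unset Strict Implicit.
Unset Printing Implicit Defensive.

Import Order.TTheory GRing.Theory Num.Theory.
Import numFieldNormedType.Exports.

Local Open Scope classical_set_scope.
Local Open Scope ring_scope.

(* The index set is finite, so the product rule for the full family is mutual
   independence: taking B i = setT drops the index i. *)
Definition mutually_independent (d : measure_display) (T : measurableType d)
    (R : realType) (P : probability T R) (I : finType)
    (X : I -> {RV P >-> R}) : Prop :=
  forall B : I -> set R, (forall i, measurable (B i)) ->
    P (\bigcap_(i in [set: I]) X i @^-1` B i) =
    (\prod_(i : I) P (X i @^-1` B i))%E.

Definition fair_sign (d : measure_display) (T : measurableType d)
    (R : realType) (P : probability T R) (X : {RV P >-> R}) : Prop :=
  P (X @^-1` [set 1]) = (2^-1)%:E /\ P (X @^-1` [set -1]) = (2^-1)%:E.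

(* Equality of laws is required on Borel sets only, since measures are total
   functions on sets whose values off the sigma-algebra carry no meaning. The
   X_i live on a probability space (T', Q) of their own. *)
Definition distributed_as_walk (d : measure_display) (T : measurableType d)
    (R : realType) (P : probability T R) (N : nat) (S : {RV P >-> R}) : Prop :=
  exists (d' : measure_display) (T' : measurableType d')
    (Q : probability T' R) (X : 'I_N -> {RV Q >-> R}),
    [/\ mutually_independent X,
        forall i, fair_sign (X i) &
        forall B : set R, measurable B ->
          P (S @^-1` B) = Q [set w | B (\sum_(i < N) X i w)]].

(* Main.v *)
Require Import Defs.
From HB Require Import structures.
From mathcomp Require Import all_boot all_order all_algebra fingroup perm.
From mathcomp Require Import all_classical all_reals all_analysis.
From mathcomp Require Import ring lra zify.

(* Write n = 2M, S_n = 2K and S_4n = 2J, and let F, G be the upper tails of K, J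
   and a, b their weights. In the monotone coupling of K and J, the theorem
   follows from the symmetry of the two laws and two comparisons of tails:
   (A) F(k) <= G(2k - 1) for k >= 1, and
   (B) G(j) <= F(k) whenever k >= 1 and 2k + 5/2 < j - j^2/(8M).
   For (A), comparing ratios of consecutive terms gives a_i <= b_{2i-1} + b_{2i}
   for i >= 1. For (B), real cut points t_k are chosen, bounded by the solution t
   of t - t^2/(8M) = 2k + 5/2, and b is spread out as a step function: the bound
   (t_{k+1} - t_k) b_j <= a_k for j > t_k - 1 shows that the integral of the step
   function beyond t_k is at most F(k). That bound comes from Gaussian estimates,
   b_j <= b_0 exp(-2j^2/(8M+1)) and
   a_k >= a_0 exp(-2k^2/(2M+1) - 6k^4/(2M+1)^3), valid for k <= 0.885 M; for
   larger k a Chernoff bound gives G <= 4^{-M} <= F(k). *)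

Set Implicit Arguments.
Unset Strict Implicit.
Unset Printing Implicit Defensive.

Import Order.TTheory GRing.Theory Num.Theory.
Import numFieldNormedType.Exports.

Local Open Scope ring_scope.

(** * Symmetric binomial weights and their tails *)

Lemma eq_divf (F : fieldType) (x y c : F) : c != 0 -> c * x = y -> x = y / c.
Proof. by move=> c0 <-; rewrite mulrC mulKf. Qed.

(** The probability that a walk of [2 * N] steps ends at [2 * k]. Only [k >= 0] is represented, the
    law being symmetric. *)
Definition binw (R : realFieldType) (N k : nat) : R :=
  'C(2 * N, N + k)%:R / 4 ^+ N.

Definition bintail (R : realFieldType) (N k : nat) : R :=
  \sum_(k <= i < N.+1) binw R N i.

Lemma binw_ge0 (R : realFieldType) N k : 0 <= binw R N k.
Proof. by rewrite divr_ge0 ?exprn_ge0. Qed.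

Lemma bintailS (R : realFieldType) N k : (k <= N)%N ->
  bintail R N k = binw R N k + bintail R N k.+1.
Proof. by move=> kN; rewrite /bintail big_ltn. Qed.

Lemma bintail_over (R : realFieldType) N k : (N < k)%N -> bintail R N k = 0.
Proof. by move=> Nk; rewrite /bintail big_geq. Qed.

Lemma bintail_ge0 (R : realFieldType) N k : 0 <= bintail R N k.
Proof. by rewrite sumr_ge0// => i _; exact: binw_ge0. Qed.

(** The ratio of consecutive weights, multiplied out so that it also holds for [k >= N], where both
    sides vanish. *)
Lemma binwS (R : realFieldType) N k :
  (N%:R + k%:R + 1) * binw R N k.+1 = (N%:R - k%:R) * binw R N k.
Proof.
rewrite /binw; have [kN|Nk] := leqP k N; last first.
  by rewrite !bin_small ?mul0r ?mulr0//; lia.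
have := congr1 (fun m => m%:R : R) (mul_bin_left (2 * N) (N + k)).
have -> : (2 * N - (N + k) = N - k)%N by lia.
rewrite !natrM natrB// addnS -natr1 natrD => e.
by rewrite mulrA e mulrA.
Qed.

Lemma binw_central_step (R : realFieldType) N :
  (2 * N%:R + 2) * binw R N.+1 0 = (2 * N%:R + 1) * binw R N 0.
Proof.
have e1 := mul_bin_diag (2 * N).+2 N.
have e2 := mul_bin_left (2 * N).+1 N.
have e3 := mul_bin_diag (2 * N).+1 N.
have e4 := mul_bin_left (2 * N) N.
rewrite /= in e1 e2 e3 e4.
have s1 : 'C((2 * N).+1, N.+1) = 'C((2 * N).+1, N).
  by apply/eqP; rewrite -(eqn_pmul2l (ltn0Sn N)) e2; apply/eqP; congr (_ * _)%N; lia.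
have e : ('C((2 * N).+2, N.+1) * N.+1 = 2 * ((2 * N).+1 * 'C(2 * N, N)))%N.
  by rewrite mulnC -e1 e3 s1; lia.
have {}e := congr1 (fun m => m%:R : R) e.
rewrite /binw !addn0 exprS.
have -> : (2 * N.+1 = (2 * N).+2)%N by lia.
move: e; rewrite !natrM -(natr1 N) -(natr1 (2 * N)) natrM => e.
have N0 : 0 <= N%:R :> R by [].
have p0 : (4 : R) ^+ N != 0 by rewrite expf_neq0 ?pnatr_eq0.
move: e p0; set C := 'C((2 * N).+2, _)%:R; set D := 'C(_, _)%:R; set p := 4 ^+ N.
move=> {e1 e2 e3 e4 s1} e p0; have -> : C = 2 * ((2 * N%:R + 1) * D) / (N%:R + 1).
  by rewrite -e; field; lra.
by field; rewrite p0; lra.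
Qed.

(** Together with the next lemma this is the Wallis sandwich: with [w] the central weight, [N w^2]
    increases and [(N + 1/2) w^2] decreases. Comparing [M] with [4 M] puts [2 b_0 / a_0] between [1]
    and [1 + 3/(16 M)]. *)
Lemma binw_central_incr (R : realFieldType) N m :
  N%:R * binw R N 0 ^+ 2 <= (N + m)%:R * binw R (N + m) 0 ^+ 2.
Proof.
elim: m => [|m ih]; first by rewrite addn0.
apply: (le_trans ih); rewrite addnS -natr1; set n := (N + m)%N.
have := binw_central_step R n; set x := binw R n.+1 0; set y := binw R n 0 => e.
have n0 : 0 <= n%:R :> R by [].
have -> : x = (2 * n%:R + 1) * y / (2 * n%:R + 2) by rewrite -e; field; lra.
rewrite -subr_ge0.
have -> : (n%:R + 1) * ((2 * n%:R + 1) * y / (2 * n%:R + 2)) ^+ 2 - n%:R * y ^+ 2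
  = y ^+ 2 / (4 * (n%:R + 1)).
  by field; lra.
by rewrite divr_ge0 ?sqr_ge0//; lra.
Qed.

Lemma binw_central_decr (R : realFieldType) N m :
  ((N + m)%:R + 2^-1) * binw R (N + m) 0 ^+ 2 <= (N%:R + 2^-1) * binw R N 0 ^+ 2.
Proof.
elim: m => [|m ih]; first by rewrite addn0.
apply: le_trans ih; rewrite addnS -natr1; set n := (N + m)%N.
have := binw_central_step R n; set x := binw R n.+1 0; set y := binw R n 0 => e.
have n0 : 0 <= n%:R :> R by [].
have -> : x = (2 * n%:R + 1) * y / (2 * n%:R + 2) by rewrite -e; field; lra.
rewrite -subr_ge0.
have -> : (n%:R + 2^-1) * y ^+ 2 - (n%:R + 1 + 2^-1) *
     ((2 * n%:R + 1) * y / (2 * n%:R + 2)) ^+ 2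
  = y ^+ 2 * (2 * n%:R + 1) / (8 * (n%:R + 1) ^+ 2).
  by field; lra.
apply: divr_ge0; first by rewrite mulr_ge0 ?sqr_ge0//; lra.
by rewrite mulr_ge0 ?sqr_ge0.
Qed.

Lemma binw_central_le (R : realFieldType) M : binw R M 0 <= 2 * binw R (4 * M) 0.
Proof.
case: M => [|M]; first by have := binw_ge0 R 0 0; rewrite muln0; lra.
set m := M.+1.
have := binw_central_incr R m (3 * m); have -> : (m + 3 * m = 4 * m)%N by lia.
have m0 : 0 < m%:R :> R by rewrite ltr0n.
rewrite natrM -mulrA [4 * (_ * _)]mulrCA ler_pM2l// => h.
rewrite -(@ler_pXn2r _ 2) ?nnegrE ?binw_ge0//; first by nra.
by have := binw_ge0 R (4 * m) 0; lra.
Qed.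

Lemma binw_central_ge (R : realFieldType) M : (0 < M)%N ->
  2 * binw R (4 * M) 0 <= (1 + 3 / (16 * M%:R)) * binw R M 0.
Proof.
move=> M0; have m0 : 0 < M%:R :> R by rewrite ltr0n.
have := binw_central_decr R M (3 * M); have -> : (M + 3 * M = 4 * M)%N by lia.
have b0 := binw_ge0 R (4 * M) 0; have a0 := binw_ge0 R M 0.
have e0 : 0 <= 3 / (16 * M%:R) :> R by rewrite divr_ge0//; lra.
set e := 3 / (16 * M%:R) in e0 *.
have eM : e * M%:R = 3 / 16 by rewrite /e; field; lra.
rewrite natrM => h.
rewrite -(@ler_pXn2r _ 2) ?nnegrE//; first last.
- by rewrite mulr_ge0//; lra.
- by lra.
set a := binw R M 0 in h a0 *; set b := binw R (4 * M) 0 in h b0 *.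
rewrite -(ler_pM2l (_ : 0 < 4 * M%:R + 2^-1)); last by lra.
have : (4 * M%:R + 2) * a ^+ 2 <= (4 * M%:R + 2^-1) * ((1 + e) * a) ^+ 2.
  have a2 : 0 <= a ^+ 2 by rewrite sqr_ge0.
  (* The first-order term in [e] suffices: [8 e M = 3/2] makes up the difference between [1/2] and
     [2]. *)
  have /(ler_wpM2r a2) : 4 * M%:R + 2 <= (4 * M%:R + 2^-1) * (1 + e) ^+ 2.
    have e2 : 0 <= e ^+ 2 by rewrite sqr_ge0.
    by clear h; nra.
  by rewrite -mulrA -exprMn.
by nra.
Qed.

(* By comparison of the ratios of consecutive terms. The induction starts at
   index 1: binw M 0 <= 2 * binw (4 * M) 0 holds, but binw M 0 exceeds
   binw (4 * M) 0 + binw (4 * M) 1 for large M. *)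
Lemma binw_le_pair (R : realFieldType) M i : (0 < M)%N ->
  binw R M i.+1 <= binw R (4 * M) (2 * i).+1 + binw R (4 * M) (2 * i).+2.
Proof.
move=> M0; have m0 : 1 <= M%:R :> R by rewrite ler1n.
elim: i => [|i ih].
  have := binwS R M 0; have := binwS R (4 * M) 0; have := binwS R (4 * M) 1.
  have := binw_central_le R M; have := binw_ge0 R M 0.
  rewrite natrM muln0; set a := binw _ M 0; set b := binw _ (4 * M) 0.
  set a1 := binw _ M 1; set b1 := binw _ (4 * M) 1; set b2 := binw _ (4 * M) 2.
  set m := M%:R in m0 * => a0 ab e2 e1 ea.
  have {e1}eb1 : b1 = 4 * m * b / (4 * m + 1).
    by apply: eq_divf; [lra|nra].
  have {e2}eb2 : b2 = (4 * m - 1) * b1 / (4 * m + 2).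
    by apply: eq_divf; [lra|nra].
  have {ea}ea : a1 = m * a / (m + 1).
    by apply: eq_divf; [lra|nra].
  apply: (@le_trans _ _ (m * (2 * b) / (m + 1))).
    by rewrite ea ler_pM2r ?invr_gt0 ?ler_pM2l//; lra.
  rewrite eb2 eb1 -subr_ge0.
  have -> : 4 * m * b / (4 * m + 1) +
    (4 * m - 1) * (4 * m * b / (4 * m + 1)) / (4 * m + 2) - m * (2 * b) / (m + 1)
   = b * (12 * m ^+ 2) / ((4 * m + 1) * (4 * m + 2) * (m + 1)).
    by field; lra.
  have b0 : 0 <= b by exact: binw_ge0.
  apply: divr_ge0; first by apply: mulr_ge0 => //; nra.
  by rewrite !mulr_ge0//; lra.
have [Mi|iM] := leqP M i.+1.
  rewrite {1}/binw bin_small ?mul0r; last by lia.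
  by rewrite addr_ge0 ?binw_ge0.
have := binwS R M i.+1; have := binwS R (4 * M) (2 * i).+1.
have := binwS R (4 * M) (2 * i).+2; have := binwS R (4 * M) (2 * i).+3.
have -> : (2 * i.+1 = (2 * i).+2)%N by lia.
have := binw_ge0 R (4 * M) (2 * i).+1; move: ih.
have : i%:R + 2 <= M%:R :> R by rewrite -natrD ler_nat; lia.
have : 0 <= i%:R :> R by [].
rewrite -!natr1 !natrM.
set b1 := binw _ _ (2 * i).+1; set b2 := binw _ _ (2 * i).+2.
set b3 := binw _ _ (2 * i).+3; set b4 := binw _ _ (2 * i).+4.
set a1 := binw _ _ i.+1; set a2 := binw _ _ i.+2.
set m := M%:R in m0 *; set x := i%:R => x0 xm ih b10 e4 e3 e2 ea.
have {}e2 : b2 = (4 * m - 2 * x - 1) * b1 / (4 * m + 2 * x + 2).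
  by apply: eq_divf; [lra|nra].
have {}e3 : b3 = (4 * m - 2 * x - 2) * b2 / (4 * m + 2 * x + 3).
  by apply: eq_divf; [lra|nra].
have {}e4 : b4 = (4 * m - 2 * x - 3) * b3 / (4 * m + 2 * x + 4).
  by apply: eq_divf; [lra|nra].
have {}ea : a2 = (m - x - 1) * a1 / (m + x + 2).
  by apply: eq_divf; [lra|nra].
apply: (@le_trans _ _ ((m - x - 1) * (b1 + b2) / (m + x + 2))).
  by rewrite ea ler_pM2r ?invr_gt0 ?ler_pM2l//; lra.
rewrite -subr_ge0 e4 e3 e2.
set X := (X in 0 <= X).
(* With [y = x + 1 <= m], the last factor of the numerator is [4 m (m - y) + m + 4 y^3 + 4 y^2],
   hence nonnegative. *)
have -> : X = b1 * (8 * m + 1) * 2 *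
    (4 * m ^+ 2 + m * (1 - 4 * (x + 1)) + 4 * (x + 1) ^+ 3 + 4 * (x + 1) ^+ 2)
  / ((4 * m + 2 * x + 2) * (4 * m + 2 * x + 3) * (4 * m + 2 * x + 4) * (m + x + 2)).
  by rewrite /X; field; lra.
apply: divr_ge0; last by rewrite !mulr_ge0//; lra.
apply: mulr_ge0; first by clearbody b1; rewrite !mulr_ge0//; lra.
have : 0 <= (x + 1) ^+ 3 by rewrite exprn_ge0//; lra.
nra.
Qed.

(** Each [a_i] with [i >= k] is matched with [b_{2i-1} + b_{2i}], and these pairs tile the indices
    from [2k - 1] on. *)
Lemma bintail_upper (R : realFieldType) M k : (0 < M)%N -> (0 < k)%N ->
  bintail R M k <= bintail R (4 * M) (2 * k).-1.
Proof.
move=> M0; case: k => // k _.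
have [d] := ubnP (M - k); elim: d k => // d ih k dk.
have [Mk|kM] := leqP M k.
  by rewrite bintail_over ?bintail_ge0//; lia.
have -> : ((2 * k.+1).-1 = (2 * k).+1)%N by lia.
rewrite bintailS; last by lia.
rewrite [X in _ <= X]bintailS; last by lia.
rewrite [X in _ <= _ + X]bintailS; last by lia.
rewrite addrA lerD ?binw_le_pair//.
have := ih k.+1; have -> : ((2 * k.+2).-1 = (2 * k).+3)%N by lia.
by apply; lia.
Qed.

(** * Gaussian bounds for the weights *)

Lemma derive_ge0_le (R : realType) (f df : R -> R) (x : R) :
  (forall y : R, is_derive y 1 f (df y)) -> (forall y, 0 <= y -> 0 <= df y) ->
  0 <= x -> f 0 <= f x.
Proof.
move=> fdf df0 x0.
have [|c cx e] := @MVT_segment R f df 0 x x0 (fun y _ => fdf y).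
  apply: continuous_subspaceT => y; apply: differentiable_continuous.
  by apply/derivable1_diffP; exact: (@ex_derive _ _ _ _ _ _ _ (fdf y)).
rewrite -subr_ge0 e subr0 mulr_ge0// df0//.
by move: cx; rewrite in_itv/= => /andP[].
Qed.

Lemma expR_ge_quad (R : realType) (x : R) : 0 <= x -> 1 + x + x ^+ 2 / 2 <= expR x.
Proof.
move=> x0; rewrite -subr_ge0.
pose f (y : R) := expR y - (1 + y + 2^-1 * y ^+ 2).
have := @derive_ge0_le R f (fun y => expR y - (1 + y)) x.
have -> : f 0 = 0 by rewrite /f expR0; ring.
have -> : f x = expR x - (1 + x + x ^+ 2 / 2) by rewrite /f; ring.
apply => // [y|y y0]; last by rewrite subr_ge0 expR_ge1Dx.
rewrite /f; apply: is_derive_eq.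
by rewrite /GRing.scale/=; field.
Qed.

Lemma expR_ge_cubic (R : realType) (x : R) : 0 <= x ->
  1 + x + x ^+ 2 / 2 + x ^+ 3 / 6 <= expR x.
Proof.
move=> x0; rewrite -subr_ge0.
pose f (y : R) := expR y - (1 + y + 2^-1 * y ^+ 2 + 6^-1 * y ^+ 3).
have := @derive_ge0_le R f (fun y => expR y - (1 + y + y ^+ 2 / 2)) x.
have -> : f 0 = 0 by rewrite /f expR0; ring.
have -> : f x = expR x - (1 + x + x ^+ 2 / 2 + x ^+ 3 / 6) by rewrite /f; ring.
apply => // [y|y y0]; last by rewrite subr_ge0 expR_ge_quad.
rewrite /f; apply: is_derive_eq.
by rewrite /GRing.scale/=; field.
Qed.

(** For [z < 1] this is [artanh z >= z], freed of the logarithm. Multiplied by [expR z], the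
    difference of the two sides has derivative [z (e^z - e^-z)]. *)
Lemma artanh_lower (R : realType) (z : R) : 0 <= z ->
  1 - z <= (1 + z) * expR (- (2 * z)).
Proof.
move=> z0.
pose f (y : R) := (1 + y) * expR (- y) - (1 - y) * expR y.
have := @derive_ge0_le R f (fun y => y * (expR y - expR (- y))) z.
have -> : f 0 = 0 by rewrite /f oppr0 expR0; ring.
have h : 0 <= f z -> 1 - z <= (1 + z) * expR (- (2 * z)).
  rewrite /f subr_ge0 -(ler_pM2r (expR_gt0 (- z))) -!mulrA -!expRD subrr expR0.
  by rewrite mulr1; congr (_ <= _ * expR _); ring.
move=> H; apply/h/H => // {h H} [y|y y0]; last first.
  by rewrite mulr_ge0// subr_ge0 ler_expR; lra.
rewrite /f; apply: is_derive_eq.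
by rewrite /GRing.scale/=; ring.
Qed.

(** This amounts to [artanh z <= z + 3/2 z^3]. On this range the cubic Taylor polynomial of the
    exponential at [2 z + 3 z^3] is large enough. *)
Lemma artanh_upper (R : realType) (z : R) : 0 <= z <= 177 / 200 ->
  (1 + z) * expR (- (2 * z + 3 * z ^+ 3)) <= 1 - z.
Proof.
move=> /andP[z0 z1]; set u := 2 * z + _.
have u0 : 0 <= u by rewrite /u; have := exprn_ge0 3 z0; lra.
rewrite expRN ler_pdivrMr ?expR_gt0//.
apply: le_trans (ler_wpM2l _ (expR_ge_cubic u0)); last by lra.
rewrite -subr_ge0.
have -> : (1 - z) * (1 + u + u ^+ 2 / 2 + u ^+ 3 / 6) - (1 + z) =
  z ^+ 3 * ((1 - z) * (7 / 3 + 6 * z + 6 * z ^+ 2 + 9 * z ^+ 4) - 2 * z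
   + (1 - z) * (9 / 2 * z ^+ 3 + 9 / 2 * z ^+ 6)) by rewrite /u; field.
apply: mulr_ge0; first by rewrite exprn_ge0.
apply: addr_ge0; last first.
  by apply: mulr_ge0; [lra|have := exprn_ge0 3 z0; have := exprn_ge0 6 z0; lra].
have [zs|zb] := leP z (2 / 5).
  have : 0 <= z ^+ 4 by rewrite exprn_ge0.
  nra.
(* The square of [z^2] is bounded below by its tangent at [z^2 = 7/10], which lowers the degree. *)
have h : 14 / 10 * z ^+ 2 - 49 / 100 <= z ^+ 4.
  by have := sqr_ge0 (z ^+ 2 - 7 / 10); nra.
apply: (@le_trans _ _ ((1 - z) * (- (208 / 100) + 6 * z + 186 / 10 * z ^+ 2) - 2 * z)).
  by nra.
by rewrite lerB// ler_wpM2l//; lra.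
Qed.

(** Consecutive weights have ratio [(1 - z) / (1 + z)] with [z = (2j + 1) / (2N + 1)], and [2 z] is
    exactly the increment of [2 j^2 / (2N + 1)]. *)
Lemma binw_le_expR (R : realType) N j :
  binw R N j <= binw R N 0 * expR (- (2 * j%:R ^+ 2 / (2 * N%:R + 1))).
Proof.
elim: j => [|j ih].
  by rewrite expr0n/= mulr0 mul0r oppr0 expR0 mulr1.
have [Nj|jN] := leqP N j.
  by rewrite {1}/binw bin_small ?mul0r ?mulr_ge0 ?binw_ge0 ?expR_ge0//; lia.
have : j%:R + 1 <= N%:R :> R by rewrite natr1 ler_nat.
have j0 : 0 <= j%:R :> R by [].
have := binwS R N j; rewrite -(natr1 j); move: ih j0.
have := binw_ge0 R N j; have := binw_ge0 R N 0.
set n := N%:R; set x := j%:R; set w := binw R N j; set w1 := binw R N j.+1.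
set w0 := binw R N 0 => w00 wg0 ih x0 e xn.
have {e}-> : w1 = (n - x) * w / (n + x + 1) by apply: eq_divf; [lra|nra].
pose z := (2 * x + 1) / (2 * n + 1).
have z0 : 0 <= z by rewrite divr_ge0//; lra.
rewrite ler_pdivrMr; last by lra.
have -> : - (2 * (x + 1) ^+ 2 / (2 * n + 1)) =
   - (2 * x ^+ 2 / (2 * n + 1)) - 2 * z by rewrite /z; field; lra.
rewrite expRD.
have := artanh_lower z0.
have -> : 1 - z = 2 * (n - x) / (2 * n + 1) by rewrite /z; field; lra.
have -> : 1 + z = 2 * (n + x + 1) / (2 * n + 1) by rewrite /z; field; lra.
rewrite [X in _ <= X]mulrAC ler_pM2r ?invr_gt0; last by lra.
set E := expR (- (2 * z)) => h.
apply: (@le_trans _ _ ((n - x) * (w0 * expR (- (2 * x ^+ 2 / (2 * n + 1)))))).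
  by rewrite ler_wpM2l//; lra.
set F := expR _; have F0 : 0 <= w0 * F by rewrite mulr_ge0// expR_ge0.
by clearbody w0 F E; nra.
Qed.

(** The same induction with the upper bound for artanh: the increment of the exponent exceeds
    [2 z + 3 z^3] by [(6k + 3) / (2N + 1)^3]. *)
Lemma binw_ge_expR (R : realType) N k : (200 * k <= 177 * N)%N ->
  binw R N 0 * expR (- (2 * k%:R ^+ 2 / (2 * N%:R + 1) +
    6 * k%:R ^+ 4 / (2 * N%:R + 1) ^+ 3)) <= binw R N k.
Proof.
elim: k => [|k ih] kN.
  by rewrite !expr0n/= !mulr0 !mul0r addr0 oppr0 expR0 mulr1.
have {ih} := ih (leq_trans (leq_mul (leqnn _) (leqnSn _)) kN).
have : 200 * (k%:R + 1) <= 177 * N%:R :> R by rewrite natr1 -!natrM ler_nat.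
have k0 : 0 <= k%:R :> R by [].
have := binwS R N k; rewrite -(natr1 k); move: k0.
have := binw_ge0 R N k; have := binw_ge0 R N 0.
set n := N%:R; set x := k%:R; set w := binw R N k; set w1 := binw R N k.+1.
set w0 := binw R N 0 => w00 wg0 x0 e xn ih.
have {e}-> : w1 = (n - x) * w / (n + x + 1) by apply: eq_divf; [lra|nra].
have n0 : 0 < 2 * n + 1 by lra.
pose z := (2 * x + 1) / (2 * n + 1).
have z0 : 0 <= z by rewrite divr_ge0//; lra.
have z1 : z <= 177 / 200 by rewrite ler_pdivrMr; lra.
rewrite ler_pdivlMr; last by lra.
have le1 : - (2 * (x + 1) ^+ 2 / (2 * n + 1) + 6 * (x + 1) ^+ 4 / (2 * n + 1) ^+ 3)
   <= - (2 * x ^+ 2 / (2 * n + 1) + 6 * x ^+ 4 / (2 * n + 1) ^+ 3)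
      - (2 * z + 3 * z ^+ 3).
  rewrite -subr_ge0; set X := (X in 0 <= X).
  have -> : X = (6 * x + 3) / (2 * n + 1) ^+ 3 by rewrite /X /z; field; lra.
  by rewrite divr_ge0 ?exprn_ge0//; lra.
have zz : 0 <= z <= 177 / 200 by rewrite z0.
have := artanh_upper zz.
have -> : 1 - z = 2 * (n - x) / (2 * n + 1) by rewrite /z; field; lra.
have -> : 1 + z = 2 * (n + x + 1) / (2 * n + 1) by rewrite /z; field; lra.
rewrite [X in X <= _]mulrAC ler_pM2r ?invr_gt0//.
move: le1; rewrite -ler_expR expRD.
set E := expR (- (2 * z + _)); set G := expR _; set F := expR _ => le1 h.
have E0 : 0 <= E by rewrite expR_ge0.
have F0 : 0 <= F by rewrite expR_ge0.
apply: (@le_trans _ _ (w0 * (F * E) * (n + x + 1))).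
  by rewrite -!mulrA ler_wpM2l// ler_wpM2l//; nra.
apply: (@le_trans _ _ (w0 * F * (n - x))).
  by rewrite -!mulrA !ler_wpM2l//; lra.
by rewrite [X in X <= _]mulrC ler_wpM2l//; lra.
Qed.

(** * The lower tail comparison *)

(* The integral over [t, +oo[ of the step function equal to [b j] on [j, j + 1[. *)
Definition step_integral (R : realFieldType) (b : nat -> R) (N : nat) (t : R) : R :=
  \sum_(0 <= j < N) b j * (Num.max 0 (j.+1%:R - t) - Num.max 0 (j%:R - t)).

Lemma step_integral_ge (R : realFieldType) (b : nat -> R) N j t :
  (forall i, 0 <= b i) -> t <= j%:R -> \sum_(j <= i < N) b i <= step_integral b N t.
Proof.
move=> b0 tj; rewrite /step_integral; have [jN|Nj] := leqP j N; last first.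
  rewrite (big_geq (ltnW Nj)) sumr_ge0// => i _; rewrite mulr_ge0// subr_ge0.
  by rewrite le_max2// lerB// ler_nat.
rewrite (big_cat_nat (leq0n j) jN)/= -[X in X <= _]add0r lerD//.
  rewrite sumr_ge0// => i _; rewrite mulr_ge0// subr_ge0.
  by rewrite le_max2// lerB// ler_nat.
rewrite !big_nat ler_sum// => i /andP[ji _].
have ji' : j%:R <= i%:R :> R by rewrite ler_nat.
rewrite ler_peMr// -natr1 !max_r; lra.
Qed.

Lemma step_integral_le (R : realFieldType) (b : nat -> R) N j t :
  (forall i, 0 <= b i) -> j%:R <= t -> step_integral b N t <= \sum_(j <= i < N) b i.
Proof.
move=> b0 tj; rewrite /step_integral; have [jN|Nj] := leqP j N; last first.
  rewrite (big_geq (ltnW Nj)) big_nat big1// => i /andP[_ iN].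
  have ij : i.+1%:R <= j%:R :> R by rewrite ler_nat; lia.
  by have := ler_nat R i i.+1; rewrite leqnSn => ?; rewrite !max_l ?subrr ?mulr0//; lra.
rewrite (big_cat_nat (leq0n j) jN)/= [X in X + _]big_nat big1 ?add0r => [|i /andP[_ ij]].
  rewrite !big_nat ler_sum// => i _; rewrite ler_piMr// -natr1.
  by case: (leP 0 (i%:R + 1 - t)); case: (leP 0 (i%:R - t)); lra.
have ij' : i.+1%:R <= j%:R :> R by rewrite ler_nat.
by have := ler_nat R i i.+1; rewrite leqnSn => ?; rewrite !max_l ?subrr ?mulr0//; lra.
Qed.

(** The blocks [[i, i + 1[] that reach past [t] are those with [t < i + 1], so the integrand is at
    most [c] on [[t, t'[]; the lengths that the blocks cut out of this interval telescope. *)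
Lemma step_integral_lipschitz (R : realFieldType) (b : nat -> R) N t t' c :
  0 <= t <= t' -> 0 <= c -> (forall i, t < i.+1%:R -> b i <= c) ->
  step_integral b N t - step_integral b N t' <= c * (t' - t).
Proof.
move=> /andP[t0 tt'] c0 bc; rewrite /step_integral -sumrB.
pose p (i : nat) (s : R) := Num.max 0 (i%:R - s).
have pd i : p i t' <= p i t by rewrite /p le_max2// lerB.
apply: (@le_trans _ _ (\sum_(0 <= i < N) c * ((p i.+1 t - p i.+1 t') - (p i t - p i t')))).
  apply: ler_sum => i _; rewrite -mulrBr.
  have -> : p i.+1 t - p i.+1 t' - (p i t - p i t') =
    (p i.+1 t - p i t) - (p i.+1 t' - p i t') by ring.
  have [it|ti] := leP i.+1%:R t.
    have i1 := ler_nat R i i.+1; rewrite leqnSn in i1.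
    by rewrite /p !max_l ?subrr ?mulr0//; lra.
  apply: ler_wpM2r; last exact: bc.
  rewrite /p -natr1; case: (leP 0 (i%:R + 1 - t)); case: (leP 0 (i%:R - t));
  case: (leP 0 (i%:R + 1 - t')); case: (leP 0 (i%:R - t')); lra.
rewrite -mulr_sumr telescope_sumr// ler_wpM2l//.
rewrite {3 4}/p !max_l ?subr0; try lra.
rewrite /p; case: (leP 0 (N%:R - t)); case: (leP 0 (N%:R - t')); lra.
Qed.

(** * Chernoff bound far from the centre *)

Lemma bernoulli_ineq (R : realFieldType) (x : R) n : 0 <= x -> 1 + n%:R * x <= (1 + x) ^+ n.
Proof.
move=> x0; elim: n => [|n ih]; first by rewrite mul0r addr0.
have n0 : 0 <= n%:R :> R by [].
rewrite exprS -(natr1 n); apply: le_trans (ler_wpM2l _ ih); last by lra.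
by nra.
Qed.

(** The binomial theorem for [(1 + 4)^(2N)], with only the upper half of the sum kept. The tilt 4 is
    near the optimal value [19/5] for a tail from [7N/12] on, the case in which the bound is
    applied. *)
Lemma sum_binw_expn (R : realFieldType) N :
  \sum_(0 <= i < N.+1) binw R N i * 4 ^+ (N + i) <= 25 ^+ N / 4 ^+ N.
Proof.
rewrite ler_pdivlMr ?exprn_gt0// mulr_suml.
have -> : 25 ^+ N = \sum_(0 <= i < (2 * N).+1) 'C(2 * N, i)%:R * 4 ^+ i :> R.
  have -> : 25 ^+ N = (1 + 4) ^+ (2 * N) :> R.
    by rewrite exprM; congr (_ ^+ _); ring.
  rewrite exprDn big_mkord; apply: eq_bigr => i _.
  by rewrite expr1n mul1r mulr_natl.
rewrite [X in _ <= X](big_cat_nat (leq0n N)); last by lia.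
rewrite /= -[X in X <= _]add0r lerD//.
  by rewrite sumr_ge0// => i _; rewrite mulr_ge0 ?exprn_ge0.
rewrite -[X in _ <= \sum_(X <= _ < _) _]add0n big_addn.
have -> : ((2 * N).+1 - N = N.+1)%N by lia.
apply: ler_sum => i _; rewrite /binw mulrAC divfK ?expf_neq0 ?pnatr_eq0//.
by rewrite [(i + N)%N]addnC.
Qed.

Lemma bintail_chernoff (R : realFieldType) N j :
  bintail R N j <= 25 ^+ N / 4 ^+ (N + N + j).
Proof.
rewrite -addnA exprD invfM mulrA ler_pdivlMr ?exprn_gt0//.
apply: le_trans (sum_binw_expn R N); rewrite /bintail mulr_suml.
have [jN|Nj] := leqP j N.+1; last first.
  rewrite (big_geq (ltnW Nj)) sumr_ge0// => i _.
  by rewrite mulr_ge0 ?binw_ge0 ?exprn_ge0.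
rewrite [X in _ <= X](big_cat_nat (leq0n j) jN)/= -[X in X <= _]add0r lerD//.
  by rewrite sumr_ge0// => i _; rewrite mulr_ge0 ?binw_ge0 ?exprn_ge0.
rewrite !big_nat; apply: ler_sum => i /andP[ji _]; rewrite ler_wpM2l ?binw_ge0//.
by rewrite ler_weXn2l ?ler1n// leq_add2l.
Qed.

Lemma bintail_crude (R : realFieldType) M j : (75 <= M)%N -> (7 * M <= 3 * j + 2)%N ->
  bintail R (4 * M) j <= (4 ^+ M)^-1.
Proof.
move=> M75 Mj; apply: (le_trans (bintail_chernoff R (4 * M) j)).
rewrite ler_pdivrMr ?exprn_gt0//.
(* Cubing clears the third in [j >= (7M - 2) / 3]. *)
rewrite -(@ler_pXn2r _ 3) ?nnegrE ?mulr_ge0 ?invr_ge0 ?exprn_ge0//.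
rewrite exprMn exprVn -!exprM mulrC ler_pdivlMr ?exprn_gt0//.
apply: (@le_trans _ _ (4 ^+ (31 * M) / 16)); last first.
  rewrite ler_pdivrMr//.
  have -> : 16 = 4 ^+ 2 :> R by ring.
  by rewrite -exprD ler_weXn2l ?ler1n//; lia.
rewrite ler_pdivlMr//.
have -> : (4 * M * 3 = 12 * M)%N by lia.
rewrite [(M * 3)%N]mulnC !exprM -exprMn.
set A := 25 ^+ 12 * 4 ^+ 3; set B := 4 ^+ 31.
have A0 : 0 < A by rewrite mulr_gt0 ?exprn_gt0.
(* [B / A = 4^28 / 25^12] just exceeds [6/5]. By Bernoulli, [(6/5)^M >= 16] from [M = 75] on, which
   pays for the rounding of [j]. *)
have AB : 1 + 5^-1 <= B / A.
  rewrite ler_pdivlMr// /A /B; lra.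
have -> : B ^+ M = A ^+ M * (B / A) ^+ M by rewrite -exprMn mulrC divfK// gt_eqF.
apply: ler_wpM2l; first exact: exprn_ge0 (ltW A0).
apply: (@le_trans _ _ ((1 + 5^-1) ^+ M)); last first.
  by rewrite ler_pXn2r ?nnegrE//; first [lia|lra].
apply: le_trans (bernoulli_ineq _ _); last by [].
have : 75 <= M%:R :> R by rewrite ler_nat.
lra.
Qed.

(* The cubic Taylor polynomial of 1 - sqrt (1 - w), which is the small solution y
   of 2 y - y^2 = w; here y = t / (4 M) and w = (2 k + 5/2) / (2 M). *)
Definition cut_shape (R : realFieldType) (w : R) : R :=
  w / 2 + w ^+ 2 / 8 + w ^+ 3 / 16.

(** The polynomial core of the next lemma, after the denominators [2 + h] and [8 + h] have been
    replaced by polynomial bounds. *)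
Lemma exponent_poly_ineq (R : realFieldType) (x h : R) : 0 < h <= 1 / 100 -> h <= x <= 1 ->
  0 <= (x + 3 / 4 * h + x ^+ 2 / 4 + x ^+ 3 / 8) ^+ 2 * (1 - h / 8)
   - h * (3 / 16 * h + (x + 9 / 4 * h) / 2 + 3 / 8 * (x + 9 / 4 * h) ^+ 2)
   - x ^+ 2 * (1 - h / 2 + h ^+ 2 / 4) - 3 / 4 * x ^+ 4.
Proof.
move=> /andP[h0 h1] /andP[hx x1].
have x0 : 0 < x by lra.
set P := (X in 0 <= X).
(* The terms [x^2] cancel. The remaining terms are grouped so that the positive [x h], [x^3] and
   [x^5] absorb the negative ones, by [h <= x <= 1] and [h <= 1/100]. *)
have -> : P = (x * h - 3 / 4 * h ^+ 2 - 15 / 8 * (h ^+ 2 * x) - 63 / 32 * h ^+ 3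
    - h ^+ 2 * x ^+ 2 / 4)
  + (1 / 2 * x ^+ 3 - 7 / 16 * x ^+ 4)
  + h * x ^+ 2 * (3 / 8 - 3 / 64 * h)
  + h * x ^+ 3 * (1 / 8 - 3 / 128 * h)
  + (x ^+ 5 / 16 - 5 / 128 * (h * x ^+ 4))
  + x ^+ 5 / 8 * (- h / 16) + x ^+ 6 / 64 * (1 - h / 8).
  by rewrite /P; field.
have x2 : 0 < x ^+ 2 by rewrite exprn_gt0.
have x3 : 0 < x ^+ 3 by rewrite exprn_gt0.
have x4 : 0 < x ^+ 4 by rewrite exprn_gt0.
have x5 : 0 < x ^+ 5 by rewrite exprn_gt0.
have x6 : 0 < x ^+ 6 by rewrite exprn_gt0.
have hx2 : h ^+ 2 <= x * h by rewrite expr2 ler_wpM2r//; lra.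
have h2x : h ^+ 2 * x <= (x * h) / 100 by rewrite expr2; nra.
have h3 : h ^+ 3 <= (x * h) / 100 by rewrite exprS; nra.
have h2x2 : h ^+ 2 * x ^+ 2 <= (x * h) / 100.
  have -> : h ^+ 2 * x ^+ 2 = (x * h) * (x * h) by ring.
  by nra.
have hx4 : h * x ^+ 4 <= x ^+ 5 by rewrite [x ^+ 5]exprS ler_wpM2r//; lra.
have x43 : x ^+ 4 <= x ^+ 3 by rewrite [x ^+ 4]exprS; nra.
have p1 : 0 <= h * x ^+ 2 * (3 / 8 - 3 / 64 * h) by rewrite !mulr_ge0//; lra.
have p2 : 0 <= h * x ^+ 3 * (1 / 8 - 3 / 128 * h) by rewrite !mulr_ge0//; lra.
have p3 : 0 <= x ^+ 6 / 64 * (1 - h / 8) by rewrite !mulr_ge0//; lra.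
have p4 : x ^+ 5 * h <= x ^+ 5 / 100 by nra.
have xh : 0 < x * h by rewrite mulr_gt0.
by lra.
Qed.

(** With [x = k/M] and [h = 1/M], this compares exponents divided by [M]. On the left stand the
    ratio of the central weights, the logarithmic bound on half the gap between cut points, and the
    exponent for [a_k]; on the right stands the exponent for [b] at [t_k - 1]. *)
Lemma exponent_ineq (R : realFieldType) (x h : R) : 0 < h <= 1 / 100 -> h <= x <= 1 ->
  h * (3 / 16 * h + (x + 9 / 4 * h) / 2 + 3 / 8 * (x + 9 / 4 * h) ^+ 2)
  + 2 * x ^+ 2 / (2 + h) + 6 * x ^+ 4 / (2 + h) ^+ 3
  <= 2 * (4 * cut_shape (x + 5 / 4 * h) - h) ^+ 2 / (8 + h).
Proof.
move=> hh hx; have := exponent_poly_ineq hh hx.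
move: hh hx => /andP[h0 h1] /andP[hx x1].
have x0 : 0 < x by lra.
set T := x + _ + _ + _; set D := h * (_ + _ + _) => H.
have T0 : 0 <= T.
  have := exprn_ge0 2 (ltW x0); have := exprn_ge0 3 (ltW x0).
  by rewrite /T; lra.
have le1 : 2 * x ^+ 2 / (2 + h) <= x ^+ 2 * (1 - h / 2 + h ^+ 2 / 4).
  rewrite ler_pdivrMr; last by lra.
  rewrite -subr_ge0.
  have -> : x ^+ 2 * (1 - h / 2 + h ^+ 2 / 4) * (2 + h) - 2 * x ^+ 2 = x ^+ 2 * h ^+ 3 / 4 by field.
  by have := mulr_ge0 (exprn_ge0 2 (ltW x0)) (exprn_ge0 3 (ltW h0)); lra.
have le2 : 6 * x ^+ 4 / (2 + h) ^+ 3 <= 3 / 4 * x ^+ 4.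
  rewrite ler_pdivrMr; last by rewrite exprn_gt0//; lra.
  have h8 : 8 <= (2 + h) ^+ 3.
    have -> : 8 = 2 ^+ 3 :> R by ring.
    by rewrite ler_pXn2r ?nnegrE//; lra.
  have x4 : 0 <= x ^+ 4 by rewrite exprn_ge0//; lra.
  have -> : 6 * x ^+ 4 = 3 / 4 * x ^+ 4 * 8 by field.
  by rewrite ler_wpM2l//; lra.
have le3 : T ^+ 2 * (1 - h / 8) <= 2 * (4 * cut_shape (x + 5 / 4 * h) - h) ^+ 2 / (8 + h).
  rewrite ler_pdivlMr; last by lra.
  have TC : 2 * T <= 4 * cut_shape (x + 5 / 4 * h) - h.
    have w2 : x ^+ 2 <= (x + 5 / 4 * h) ^+ 2 by rewrite ler_pXn2r ?nnegrE//; lra.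
    have w3 : x ^+ 3 <= (x + 5 / 4 * h) ^+ 3 by rewrite ler_pXn2r ?nnegrE//; lra.
    by rewrite /cut_shape /T; lra.
  have T2 : (2 * T) ^+ 2 <= (4 * cut_shape (x + 5 / 4 * h) - h) ^+ 2.
    by rewrite ler_pXn2r ?nnegrE//; lra.
  have Tsq := sqr_ge0 T.
  by nra.
apply: (le_trans (lerD (lerD (lexx D) le1) le2)); apply: le_trans le3.
by rewrite -subr_ge0; move: H; rewrite !opprD !addrA.
Qed.

(** * The cut points [t_k] and the comparison block by block *)

Definition cut (R : realFieldType) (M k : nat) : R :=
  4 * M%:R * cut_shape ((2 * k%:R + 5 / 2) / (2 * M%:R)).

Lemma cutS (R : realFieldType) M k : (0 < M)%N -> cut R M k < cut R M k.+1.
Proof.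
move=> M0; have m0 : 0 < M%:R :> R by rewrite ltr0n.
have k0 : 0 <= k%:R :> R by [].
rewrite /cut ltr_pM2l; last by lra.
rewrite /cut_shape -(natr1 k).
set w := _ / _; set w' := (_ + 5 / 2) / _.
have w0 : 0 <= w by rewrite divr_ge0//; lra.
have ww' : w < w' by rewrite ltr_pM2r ?invr_gt0; lra.
have w2 : w ^+ 2 <= w' ^+ 2 by rewrite ler_pXn2r ?nnegrE//; lra.
have w3 : w ^+ 3 <= w' ^+ 3 by rewrite ler_pXn2r ?nnegrE//; lra.
lra.
Qed.

Lemma cut_ge1 (R : realFieldType) M k : (0 < M)%N -> 1 <= cut R M k.
Proof.
move=> M0; have m0 : 0 < M%:R :> R by rewrite ltr0n.
have k0 : 0 <= k%:R :> R by [].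
rewrite /cut /cut_shape; set w := _ / _.
have w0 : 0 <= w by rewrite divr_ge0//; lra.
have e : M%:R * w = k%:R + 5 / 4 by rewrite /w; field; lra.
have w2 : 0 <= M%:R * w ^+ 2 by rewrite mulr_ge0 ?exprn_ge0//; lra.
have w3 : 0 <= M%:R * w ^+ 3 by rewrite mulr_ge0 ?exprn_ge0//; lra.
nra.
Qed.

(** By convexity of [cut_shape] the gap is at most the slope at the right end, where the argument is
    [s]. *)
Lemma cut_gap (R : realFieldType) M k (s : R) : (0 < M)%N ->
  s = (2 * k%:R + 9 / 2) / (2 * M%:R) ->
  cut R M k.+1 - cut R M k <= 2 * (1 + (s / 2 + 3 / 8 * s ^+ 2)).
Proof.
move=> M0 sE; have m0 : 0 < M%:R :> R by rewrite ltr0n.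
have k0 : 0 <= k%:R :> R by [].
pose h : R := M%:R^-1; have h0 : 0 < h by rewrite invr_gt0.
have s0 : 0 <= s by rewrite sE divr_ge0//; lra.
rewrite /cut -(natr1 k).
have -> : (2 * (k%:R + 1) + 5 / 2) / (2 * M%:R) = s by rewrite sE; congr (_ / _); field.
have -> : (2 * k%:R + 5 / 2) / (2 * M%:R) = s - h by rewrite sE /h; field; lra.
have hs : h <= s.
  rewrite sE ler_pdivlMr; last by lra.
  have -> : h * (2 * M%:R) = 2 by rewrite /h; field; lra.
  by lra.
have -> : 4 * M%:R * cut_shape s - 4 * M%:R * cut_shape (s - h) =
  2 * (1 + (s / 2 + 3 / 8 * s ^+ 2)) - (h / 2 + 3 / 4 * s * h - h ^+ 2 / 4).
  rewrite /cut_shape /h; field; lra.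
nra.
Qed.

(** All factors are turned into exponentials: the gap is at most [2 expR d],
    [b_j <= b_0 expR (- Eb)] since [j > t_k - 1], [2 b_0 <= expR (3/(16 M)) a_0], and
    [a_k >= a_0 expR (- Ea)]. There remains [3/(16 M) + d + Ea <= Eb]. *)
Lemma cut_block_bound (R : realType) M k j : (100 <= M)%N -> (0 < k)%N ->
  (200 * k <= 177 * M)%N -> cut R M k < j.+1%:R ->
  binw R (4 * M) j * (cut R M k.+1 - cut R M k) <= binw R M k.
Proof.
move=> M100 k1 kM cj; have M0 : (0 < M)%N by lia.
have m1 : 100 <= M%:R :> R by rewrite ler_nat.
have kr1 : 1 <= k%:R :> R by rewrite ler1n.
have krM : 200 * k%:R <= 177 * M%:R :> R by rewrite -!natrM ler_nat.
have c1 := cut_ge1 R k M0.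
have b0 := binw_ge0 R (4 * M) 0; have a0 := binw_ge0 R M 0.
apply: (@le_trans _ _ (binw R M 0 * expR (- (2 * k%:R ^+ 2 / (2 * M%:R + 1) +
    6 * k%:R ^+ 4 / (2 * M%:R + 1) ^+ 3)))); last exact: binw_ge_expR.
set Ea := _ + _ / (2 * M%:R + 1) ^+ 3.
pose s : R := (2 * k%:R + 9 / 2) / (2 * M%:R).
pose d : R := s / 2 + 3 / 8 * s ^+ 2.
have d0 : 0 <= cut R M k.+1 - cut R M k by rewrite subr_ge0 ltW// cutS.
have gap : cut R M k.+1 - cut R M k <= 2 * expR d.
  apply: (le_trans (cut_gap M0 (erefl s))); rewrite ler_pM2l//; exact: expR_ge1Dx.
pose Eb : R := 2 * (cut R M k - 1) ^+ 2 / (8 * M%:R + 1).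
have bj : binw R (4 * M) j <= binw R (4 * M) 0 * expR (- Eb).
  apply: (le_trans (binw_le_expR R (4 * M) j)); rewrite ler_wpM2l// ler_expR lerN2.
  have -> : 2 * (4 * M)%:R + 1 = 8 * M%:R + 1 :> R by rewrite natrM; ring.
  apply: ler_wpM2r; first by rewrite invr_ge0; lra.
  rewrite ler_pM2l//.
  rewrite -(natr1 j) in cj.
  by rewrite ler_pXn2r ?nnegrE//; lra.
have cen : 2 * binw R (4 * M) 0 <= expR (3 / (16 * M%:R)) * binw R M 0.
  by apply: (le_trans (binw_central_ge R M0)); rewrite ler_wpM2r//; exact: expR_ge1Dx.
apply: (le_trans (ler_pM (binw_ge0 _ _ _) d0 bj gap)).
have -> : binw R (4 * M) 0 * expR (- Eb) * (2 * expR d) =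
  (2 * binw R (4 * M) 0) * (expR (- Eb) * expR d) by ring.
apply: (le_trans (ler_wpM2r _ cen)); first by rewrite mulr_ge0 ?expR_ge0.
rewrite mulrAC [X in X <= _]mulrC -!expRD ler_wpM2l// ler_expR.
pose h : R := M%:R^-1; pose x : R := k%:R * h.
have hh : 0 < h <= 1 / 100.
  rewrite invr_gt0; apply/andP; split; first by lra.
  by rewrite /h -[_^-1]div1r ler_pdivrMr; lra.
have [h0 h1] := andP hh.
have hm : M%:R * h = 1 by rewrite mulfV//; lra.
have hx : h <= x <= 1 by rewrite /x; apply/andP; split; nra.
have := exponent_ineq hh hx.
rewrite -(@ler_pM2l _ M%:R); last by lra.
have -> : M%:R * (2 * (4 * cut_shape (x + 5 / 4 * h) - h) ^+ 2 / (8 + h)) = Eb.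
  rewrite /Eb /cut.
  have -> : (2 * k%:R + 5 / 2) / (2 * M%:R) = x + 5 / 4 * h by rewrite /x /h; field; lra.
  by rewrite /h; field; lra.
have -> : M%:R * (h * (3 / 16 * h + (x + 9 / 4 * h) / 2 + 3 / 8 * (x + 9 / 4 * h) ^+ 2)
  + 2 * x ^+ 2 / (2 + h) + 6 * x ^+ 4 / (2 + h) ^+ 3) = 3 / (16 * M%:R) + d + Ea.
  by rewrite /d /Ea /s /x /h; field; lra.
lra.
Qed.

(** The threshold [177/200] is just large enough for [cut_shape] to reach [7/12], so that [t_k] lies
    where the Chernoff bound applies. *)
Lemma cut_large (R : realFieldType) M k : (0 < M)%N -> (177 * M < 200 * k)%N ->
  7 / 3 * M%:R <= cut R M k.
Proof.
move=> M0 kM; have m0 : 0 < M%:R :> R by rewrite ltr0n.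
have krM : 177 * M%:R <= 200 * k%:R :> R by rewrite -!natrM ler_nat ltnW.
rewrite /cut; set w := (_ + 5 / 2) / _.
have w0 : 177 / 200 <= w by rewrite ler_pdivlMr; lra.
have w2 : (177 / 200) ^+ 2 <= w ^+ 2 by rewrite ler_pXn2r ?nnegrE//; lra.
have w3 : (177 / 200) ^+ 3 <= w ^+ 3 by rewrite ler_pXn2r ?nnegrE//; lra.
have cw : 7 / 12 <= cut_shape w by rewrite /cut_shape; lra.
have m4 : 0 <= 4 * M%:R :> R by lra.
by apply: le_trans (ler_wpM2l m4 cw); lra.
Qed.

(** Downward induction on [k]: the integral between [t_k] and [t_{k+1}] is at most [a_k]. For
    [k > 0.885 M] the Chernoff bound replaces the induction. *)
Lemma step_integral_bintail (R : realType) M k : (100 <= M)%N -> (0 < k <= M)%N ->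
  step_integral (binw R (4 * M)) (4 * M).+1 (cut R M k) <= bintail R M k.
Proof.
move=> M100; have M0 : (0 < M)%N by lia.
have b0 i := binw_ge0 R (4 * M) i.
have m1 : 100 <= M%:R :> R by rewrite ler_nat.
have [d] := ubnP (M - k); elim: d k => // d ih k dk /andP[k0 kM].
have [kb|ks] := ltnP (177 * M) (200 * k).
  have cl := cut_large R M0 kb.
  pose j := (7 * M %/ 3)%N.
  have j1 : (3 * j <= 7 * M)%N by rewrite /j; lia.
  have j2 : (7 * M <= 3 * j + 2)%N by rewrite /j; lia.
  have jc : j%:R <= cut R M k.
    by apply: le_trans cl; have : 3 * j%:R <= 7 * M%:R :> R; [rewrite -!natrM ler_nat|lra].
  apply: (le_trans (step_integral_le (4 * M).+1 b0 jc)).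
  apply: (le_trans (bintail_crude R _ j2)); first by lia.
  (* The last term of the tail, [a_M], is already [4^{-M}]. *)
  rewrite /bintail big_nat_recr//= /binw addnn -mul2n binn mul1r lerDr.
  by rewrite sumr_ge0// => i _; exact: binw_ge0.
have kM' : (k < M)%N by lia.
rewrite bintailS//.
have /ih : (M - k.+1 < d)%N by lia.
move=> /(_ _)/(lerD (lexx (binw R M k)))-/(_ _) H.
apply: le_trans (H _); last by lia.
rewrite -lerBlDr; set I := step_integral _ _ _; set I' := step_integral _ _ _.
pose n := cut R M k.+1 - cut R M k.
have n0 : 0 < n by rewrite subr_gt0 cutS.
apply: (@le_trans _ _ ((binw R M k / n) * n)); last by rewrite divfK// gt_eqF.
apply: step_integral_lipschitz.
- by rewrite (ltW (cutS _ _ _))// (le_trans _ (cut_ge1 R k M0)).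
- by rewrite divr_ge0 ?binw_ge0// ltW.
- by move=> i ki; rewrite ler_pdivlMr//; apply: cut_block_bound.
Qed.

Lemma bintail_lower (R : realType) M j k : (100 <= M)%N -> (0 < k)%N -> (j <= 4 * M)%N ->
  2 * k%:R + 5 / 2 < j%:R - j%:R ^+ 2 / (8 * M%:R) :> R ->
  bintail R (4 * M) j <= bintail R M k.
Proof.
move=> M100 k0 jM h; have M0 : (0 < M)%N by lia.
have m0 : 0 < M%:R :> R by rewrite ltr0n.
have kr1 : 1 <= k%:R :> R by rewrite ler1n.
have jr : j%:R <= 4 * M%:R :> R by rewrite -natrM ler_nat.
pose y : R := j%:R / (4 * M%:R); pose w : R := (2 * k%:R + 5 / 2) / (2 * M%:R).
have y1 : y <= 1 by rewrite ler_pdivrMr; lra.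
have w0 : 0 <= w by rewrite divr_ge0//; lra.
have wy : w < 2 * y - y ^+ 2.
  rewrite ltr_pdivrMr; last by lra.
  apply: (lt_le_trans h); rewrite /y le_eqVlt; apply/orP; left; apply/eqP.
  by field; lra.
have kM : (k <= M)%N.
  rewrite -(ler_nat R).
  have : w < 1 by have := sqr_ge0 (1 - y); nra.
  by rewrite ltr_pdivrMr; lra.
have cj : cut R M k <= j%:R.
  have -> : j%:R = 4 * M%:R * y by rewrite /y; field; lra.
  rewrite /cut ler_pM2l; last by lra.
  rewrite leNgt; apply/negP => yc.
  have : (1 - cut_shape w) ^+ 2 <= (1 - y) ^+ 2.
    have w1 : w <= 1 by have := sqr_ge0 (1 - y); nra.
    have c1 : cut_shape w <= 1.
      have w2 : w ^+ 2 <= 1 by rewrite expr_le1.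
      have w3 : w ^+ 3 <= 1 by rewrite expr_le1.
      by rewrite /cut_shape; lra.
    by rewrite ler_pXn2r ?nnegrE//; lra.
  (* The Taylor polynomial lies below the solution [1 - sqrt (1 - w)], while [y] lies above it. *)
  have : 1 - w <= (1 - cut_shape w) ^+ 2.
    rewrite -subr_ge0.
    have -> : (1 - cut_shape w) ^+ 2 - (1 - w) =
      w ^+ 4 * (5 / 64 + w / 64 + w ^+ 2 / 256) by rewrite /cut_shape; field.
    by rewrite mulr_ge0 ?exprn_ge0//; have := exprn_ge0 2 w0; lra.
  by nra.
apply: le_trans (step_integral_bintail R M100 _); last by rewrite k0.
apply: step_integral_ge => //; exact: binw_ge0.
Qed.

(** * Comonotone rearrangement and the coupling *)

(* A permutation maximizing [\sum_x f x * g (s x)] is comonotone: otherwise a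
   transposition would increase the sum. *)
Lemma comonotone_perm (T : finType) (f g : T -> nat) :
  exists s : {perm T}, forall x y, (f x < f y)%N -> (g (s x) <= g (s y))%N.
Proof.
pose V (s : {perm T}) := (\sum_x f x * g (s x))%N.
have [s _ smax] := arg_maxnP V (erefl true : predT (1%g : {perm T})).
exists s => x y fxy; rewrite leqNgt; apply/negP => gxy.
have xy : y != x by apply: contraTneq fxy => ->; rewrite ltnn.
have VE t : V t = (f x * g (t x) + (f y * g (t y) +
    \sum_(z | (z != x) && (z != y)) f z * g (t z)))%N.
  by rewrite /V (bigD1 x)//= (bigD1 y).
have : (V (tperm x y * s)%g <= V s)%N by exact: smax.
rewrite !VE !permM tpermL tpermR.
rewrite [X in (_ + (_ + X) <= _)%N](eq_bigr (fun z => f z * g (s z))%N).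
  by move: (\sum_(z | _) _)%N => U; nia.
by move=> z /andP[zx zy]; rewrite permM tpermD// eq_sym.
Qed.

Lemma card_set_perm (T : finType) (s : {perm T}) (p : pred T) :
  #|[set x | p (s x)]| = #|[set x | p x]|.
Proof.
rewrite -(card_imset _ (@perm_inj _ s)); apply: eq_card => z.
apply/finset.imsetP/idP => [[y]|]; rewrite !inE; first by move=> py ->.
by move=> pz; exists ((s^-1)%g z); rewrite ?inE permKV.
Qed.

(** Comonotonicity makes the sets [a <= f x] and [b <= g (s x)] nested, so their cardinalities
    decide the inclusion. This turns a comparison of tails into a pointwise bound. *)
Lemma comonotone_nested (T : finType) (f g : T -> nat) (s : {perm T}) a b :
  (forall x y, (f x < f y)%N -> (g (s x) <= g (s y))%N) ->
  (#|[set x | a <= f x]| <= #|[set x | b <= g x]|)%N ->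
  forall x, (a <= f x)%N -> (b <= g (s x))%N.
Proof.
move=> mono card x ax; rewrite leqNgt; apply/negP => gx.
have : [set y | (b <= g (s y))%N] \proper [set y | (a <= f y)%N].
  apply/properP; split; last by exists x; rewrite inE// leqNgt gx.
  apply/fintype.subsetP => y; rewrite !inE => gy; rewrite leqNgt; apply/negP => fy.
  have := mono y x; lia.
move/proper_card; rewrite (card_set_perm s (fun y => b <= g y)%N); lia.
Qed.

Lemma comonotone_nested_rev (T : finType) (f g : T -> nat) (s : {perm T}) a b :
  (forall x y, (f x < f y)%N -> (g (s x) <= g (s y))%N) ->
  (#|[set x | b <= g x]| <= #|[set x | a <= f x]|)%N ->
  forall x, (b <= g (s x))%N -> (a <= f x)%N.
Proof.
move=> mono card x gx; rewrite leqNgt; apply/negP => fx.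
have : [set y | (a <= f y)%N] \proper [set y | (b <= g (s y))%N].
  apply/properP; split; last by exists x; rewrite inE// leqNgt fx.
  apply/fintype.subsetP => y; rewrite !inE => fy.
  have := mono x y; lia.
move/proper_card; rewrite (card_set_perm s (fun y => b <= g y)%N); lia.
Qed.

(** * Walks as subsets, and the coupling on a finite space *)

Lemma card_sets_ge N m :
  #|[set A : {set 'I_N} | (m <= #|A|)%N]| = (\sum_(m <= i < N.+1) 'C(N, i))%N.
Proof.
rewrite -sum1_card.
transitivity (\sum_(A : {set 'I_N}) \sum_(m <= i < N.+1) (#|A| == i))%N.
  rewrite big_mkcond/=; apply: eq_bigr => A _; rewrite inE.
  have AN : (#|A| < N.+1)%N by rewrite ltnS -[X in (_ <= X)%N]card_ord max_card.
  have [mA|Am] := leqP m #|A|.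
    rewrite (bigD1_seq #|A|) ?iota_uniq ?mem_index_iota ?mA//= eqxx big1// => i.
    by rewrite eq_sym => /negPf ->.
  rewrite big_nat big1// => i /andP[mi _]; by rewrite ltn_eqF// (leq_trans Am).
rewrite exchange_big/=; apply: eq_bigr => i _.
rewrite -[in RHS](card_ord N) -card_draws -sum1_card big_mkcond [RHS]big_mkcond/=.
by apply: eq_bigr => A _; rewrite inE; case: eqP.
Qed.

Lemma card_sets_le N m : (m <= N)%N ->
  #|[set A : {set 'I_N} | (#|A| <= m)%N]| = #|[set A : {set 'I_N} | (N - m <= #|A|)%N]|.
Proof.
move=> mN; rewrite -(card_imset _ (@finset.setC_inj 'I_N)); apply: eq_card => A.
apply/finset.imsetP/idP => [[B]|]; rewrite !inE => h.
  move=> ->; have := cardsC B; rewrite card_ord; lia.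
exists (~: A); rewrite ?finset.setCK// inE.
have := cardsC A; rewrite card_ord; lia.
Qed.

Lemma card_sets_ge_bintail (R : realFieldType) M k :
  #|[set A : {set 'I_(2 * M)} | (M + k <= #|A|)%N]|%:R = 4 ^+ M * bintail R M k.
Proof.
rewrite card_sets_ge natr_sum /bintail mulr_sumr.
rewrite [(M + k)%N]addnC big_addn; have -> : ((2 * M).+1 - M = M.+1)%N by lia.
apply: eq_bigr => i _; rewrite /binw mulrCA divff ?mulr1; last first.
  by rewrite expf_neq0 ?pnatr_eq0.
by rewrite addnC.
Qed.

(** The half of the argument with [K > 0] or [J >= 0]. The functions [f] and [g] are abstract so
    that it also applies to their reflections, which give the other half. *)
Lemma coupled_bounds (R : realType) (T : finType) (f g : T -> nat) (s : {perm T})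
    (M : nat) (c : R) (x : T) :
  (100 <= M)%N -> 0 <= c -> (g (s x) <= 8 * M)%N ->
  (forall k, #|[set y | (M + k <= f y)%N]|%:R = c * bintail R M k) ->
  (forall l, #|[set y | (4 * M + l <= g y)%N]|%:R = c * bintail R (4 * M) l) ->
  (forall y z, (f y < f z)%N -> (g (s y) <= g (s z))%N) ->
  let K := (f x)%:R - M%:R : R in let J := (g (s x))%:R - 4 * M%:R : R in
  (0 < K -> 1 <= K /\ 2 * K <= J + 1) /\
  (0 <= J -> J - J ^+ 2 / (8 * M%:R) - 9 / 2 <= 2 * `|K|).
Proof.
move=> M100 c0 g8 cf cg mono K J; split.
  rewrite subr_gt0 ltr_nat => Mf; pose k := (f x - M)%N.
  have fk : f x = (M + k)%N by rewrite /k; lia.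
  have k0 : (0 < k)%N by rewrite /k; lia.
  have KE : K = k%:R by rewrite /K fk natrD; ring.
  have gk : (4 * M + (2 * k).-1 <= g (s x))%N.
    apply: (@comonotone_nested _ f g s (M + k)) => //; last by rewrite fk.
    rewrite -(ler_nat R) cf cg ler_wpM2l// bintail_upper//; lia.
  rewrite KE; split; first by rewrite ler1n.
  have : 2 * k%:R + 4 * M%:R <= (g (s x))%:R + 1 :> R.
    by rewrite -!natrM natr1 -natrD ler_nat; lia.
  by rewrite /J; lra.
rewrite subr_ge0 -natrM ler_nat => Mg; pose j := (g (s x) - 4 * M)%N.
have gj : g (s x) = (4 * M + j)%N by rewrite /j; lia.
have JE : J = j%:R by rewrite /J gj natrD natrM; ring.
(* Truncated subtraction gives [k = 0] when [K < 0]. The tail comparison is used at [k + 1], whence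
   [9/2 = 2 + 5/2]. *)
rewrite leNgt; apply/negP => v; pose k := (f x - M)%N.
have kK : k%:R <= `|K|.
  have [Mf|fM] := leqP M (f x).
    by rewrite /K /k natrB// ler_norm.
  by have -> : k = 0%N by rewrite /k; lia.
have : (M + k.+1 <= f x)%N.
  apply: (@comonotone_nested_rev _ f g s _ (4 * M + j)) => //; last by rewrite gj.
  rewrite -(ler_nat R) cf cg ler_wpM2l// bintail_lower//; first by lia.
  by rewrite -(natr1 k) -JE; lra.
by rewrite /k; lia.
Qed.

Lemma card_pair_fst (A B : finType) (p : pred A) :
  #|[set x : A * B | p x.1]| = (#|[set a | p a]| * #|B|)%N.
Proof.
rewrite -[X in (_ * X)%N]cardsT -cardsX; apply: eq_card => -[a b].
by rewrite !inE andbT.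
Qed.

Lemma card_pair_snd (A B : finType) (p : pred B) :
  #|[set x : A * B | p x.2]| = (#|A| * #|[set b | p b]|)%N.
Proof.
rewrite -[X in (X * _)%N]cardsT -cardsX; apply: eq_card => -[a b].
by rewrite !inE.
Qed.

Lemma card_set_ord (R : pzRingType) N : #|{set 'I_N}|%:R = 2 ^+ N :> R.
Proof. by rewrite -cardsT -powersetT card_powerset cardsT card_ord natrX. Qed.

Lemma sumr_const_set (R : pzRingType) N (c : R) :
  \sum_(A : {set 'I_N}) c = 2 ^+ N * c.
Proof. by rewrite sumr_const -[LHS]mulr_natl -card_set_ord. Qed.

(** On the product both laws are counting laws of one finite set, one read from each coordinate;
    permuting the points before reading the second coordinate changes the coupling but neither
    marginal. *)
Lemma walk_coupling (R : realType) M : (100 <= M)%N ->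
  exists s : {perm {set 'I_(2 * M)} * {set 'I_(2 * (4 * M))}},
  forall x : {set 'I_(2 * M)} * {set 'I_(2 * (4 * M))},
  let K := #|x.1|%:R - M%:R : R in let J := #|(s x).2|%:R - 4 * M%:R : R in
  [/\ 0 <= K * J, `|J| - `|J| ^+ 2 / (8 * M%:R) - 9 / 2 <= 2 * `|K| &
    2 * `|K| <= `|J| + 1].
Proof.
move=> M100; pose T := ({set 'I_(2 * M)} * {set 'I_(2 * (4 * M))})%type.
pose f (x : T) := #|x.1|; pose g (x : T) := #|x.2|.
have [s mono] := comonotone_perm f g; exists s => x K J.
pose c : R := 4 ^+ M * 4 ^+ (4 * M).
have c0 : 0 <= c by rewrite mulr_ge0 ?exprn_ge0.
have pE m : 4 ^+ m = 2 ^+ (2 * m) :> R by rewrite exprM; congr (_ ^+ _); ring.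
have cf k : #|[set y | (M + k <= f y)%N]|%:R = c * bintail R M k.
  rewrite (card_pair_fst _ (fun A : {set 'I_(2 * M)} => M + k <= #|A|)%N) natrM.
  rewrite card_sets_ge_bintail.
  by rewrite card_set_ord /c [4 ^+ (4 * M)]pE; ring.
have cg l : #|[set y | (4 * M + l <= g y)%N]|%:R = c * bintail R (4 * M) l.
  rewrite (card_pair_snd _ (fun A : {set 'I_(2 * (4 * M))} => 4 * M + l <= #|A|)%N) natrM.
  rewrite card_sets_ge_bintail.
  by rewrite card_set_ord /c [4 ^+ M]pE; ring.
have f2 y : (f y <= 2 * M)%N by rewrite -[X in (_ <= X)%N]card_ord max_card.
have g2 y : (g y <= 2 * (4 * M))%N by rewrite -[X in (_ <= X)%N]card_ord max_card.
(* Reflection preserves the cardinalities of the tails by symmetry, and reversing both orders keeps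
   [s] comonotone. *)
pose f' y := (2 * M - f y)%N; pose g' y := (8 * M - g y)%N.
have cf' k : #|[set y | (M + k <= f' y)%N]|%:R = c * bintail R M k.
  rewrite -cf; congr (_%:R); have [kM|Mk] := leqP k M; last first.
    rewrite !eq_card0// => y; rewrite !inE; apply/negbTE;
      by have := f2 y; rewrite -?ltnNge /f'; lia.
  rewrite [RHS](card_pair_fst _ (fun A : {set 'I_(2 * M)} => M + k <= #|A|)%N).
  have -> : (M + k = 2 * M - (M - k))%N by lia.
  rewrite -card_sets_le; last by lia.
  rewrite -[RHS](card_pair_fst _ (fun A : {set 'I_(2 * M)} => #|A| <= M - k)%N).
  apply: eq_card => y.
  by rewrite !inE /f'; have := f2 y; rewrite /f; move: #|y.1| => m; lia.
have cg' l : #|[set y | (4 * M + l <= g' y)%N]|%:R = c * bintail R (4 * M) l.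
  rewrite -cg; congr (_%:R); have [lM|Ml] := leqP l (4 * M); last first.
    rewrite !eq_card0// => y; rewrite !inE; apply/negbTE;
      by have := g2 y; rewrite -?ltnNge /g'; lia.
  rewrite [RHS](card_pair_snd _ (fun A : {set 'I_(2 * (4 * M))} => 4 * M + l <= #|A|)%N).
  have -> : (4 * M + l = 2 * (4 * M) - (4 * M - l))%N by lia.
  rewrite -card_sets_le; last by lia.
  rewrite -[RHS](card_pair_snd _ (fun A : {set 'I_(2 * (4 * M))} => #|A| <= 4 * M - l)%N).
  apply: eq_card => y.
  by rewrite !inE /g'; have := g2 y; rewrite /g; move: #|y.2| => m; lia.
have mono' y z : (f' y < f' z)%N -> (g' (s y) <= g' (s z))%N.
  by move=> h; apply: leq_sub2l; apply: mono; move: h; rewrite /f'; lia.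
have [|h1 h2] := @coupled_bounds R _ f g s M c x M100 c0 _ cf cg mono.
  by have := g2 (s x); lia.
have [|] := @coupled_bounds R _ f' g' s M c x M100 c0 _ cf' cg' mono'.
  by rewrite /g'; lia.
have -> : (f' x)%:R - M%:R = - K :> R by rewrite /f' natrB// natrM /K /f; ring.
have -> : (g' (s x))%:R - 4 * M%:R = - J :> R.
  rewrite /g' natrB; last by have := g2 (s x); lia.
  by rewrite natrM /J /g; ring.
rewrite sqrrN normrN oppr_gt0 oppr_ge0 => h3 h4.
move: h1 h2; rewrite -/K -/J => h1 h2; rewrite real_normK ?num_real//; split.
- have [Kn|Kp|->] := ltgtP K 0; last by rewrite mul0r.
  + by have := h3 Kn; nra.
  + by have := h1 Kp; nra.
- have [J0|J0] := leP 0 J; first by rewrite ger0_norm// h2.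
  by rewrite ltr0_norm// h4// ltW.
- have [Kn|Kp|->] := ltgtP K 0; last by rewrite normr0 mulr0 addr_ge0.
  + have [_ h] := h3 Kn; rewrite (ltr0_norm Kn).
    by have := ler_norm (- J); rewrite normrN; lra.
  + by have [_ h] := h1 Kp; rewrite (gtr0_norm Kp); have := ler_norm J; lra.
Qed.

(** * Realization on a probability space *)

Local Open Scope classical_set_scope.

(** The uniform law on [T] is carried by [nat], where every set is measurable, through the
    enumeration of [T]. The default [t0] is read only at indices of mass zero. *)
Lemma uniform_on_finType (R : realType) (T : finType) (t0 : T) :
  exists P : probability nat R, forall A : set T,
    P [set w | A (nth t0 (enum T) w)] =
    (#|T|%:R^-1 * \sum_(x : T) (x \in A)%:R)%:E.
Proof.
have cT : (0 < #|T|)%N by apply/card_gt0P; exists t0.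
have r0 : 0 <= (#|T|%:R)^-1 :> R by rewrite invr_ge0.
pose m : {measure set nat -> \bar R} :=
  mscale (NngNum r0) (msum (fun k => \d_k) #|T|).
have mE (A : set nat) : m A = (#|T|%:R^-1 * \sum_(k < #|T|) (val k \in A)%:R)%:E.
  rewrite /m/= /mscale/= /msum EFinM -sumEFin; congr (_ * _)%E.
have m1 : m setT = 1%E.
  rewrite mE; under eq_bigr do rewrite in_setT.
  by rewrite sumr_const card_ord mulVf// pnatr_eq0 -lt0n.
pose P : probability nat R := HB.pack (m : set nat -> \bar R) m
  (Measure_isProbability.Build _ _ _ m m1).
exists P => A; rewrite [LHS]mE; congr (_ * _)%:E.
rewrite -[RHS]big_enum/= [RHS](big_nth t0) -cardE big_mkord.
by apply: eq_bigr => k _; congr (nat_of_bool _)%:R; apply/idP/idP; rewrite !inE.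
Qed.

Lemma measurable_nat_fun (R : realType) (f : nat -> R) : measurable_fun setT f.
Proof. by []. Qed.

Lemma nat_RV (R : realType) (P : probability nat R) (f : nat -> R) :
  exists X : {RV P >-> R}, X = f :> (nat -> R).
Proof.
pose g : {mfun nat >-> R} := HB.pack f (isMeasurableFun.Build _ _ _ _ f (measurable_nat_fun f)).
by exists g.
Qed.

(** Expanding the product selects [true] on a subset [A]. This factorization yields the independence
    of the signs of a uniform subset. *)
Lemma sum_set_prod (R : comNzRingType) (I : finType) (F : I -> bool -> R) :
  \sum_(A : {set I}) \prod_i F i (i \in A) = \prod_i (F i true + F i false).
Proof.
rewrite (bigA_distr _ _ (fun i => F i true) (fun i => F i false))/=.
by apply: eq_bigr => A _; apply: eq_bigr => i _; case: (i \in A).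
Qed.

Definition sgn_of (R : pzRingType) (b : bool) : R := if b then 1 else -1.

Lemma sum_set_coord (R : realType) N (i : 'I_N) (B : set R) :
  (2 ^+ N)^-1 * \sum_(A : {set 'I_N}) (sgn_of R (i \in A) \in B)%:R =
  ((1 \in B)%:R + (-1 \in B)%:R) / 2 :> R.
Proof.
pose F j b : R := if j == i then (sgn_of R b \in B)%:R else 1.
rewrite (eq_bigr (fun A : {set 'I_N} => \prod_j F j (j \in A))) => [|A _]; last first.
  rewrite (bigD1 i)//= /F eqxx big1 ?mulr1// => j /negPf ->.
  by [].
rewrite sum_set_prod (bigD1 i)//= {1 2}/F eqxx (eq_bigr (fun=> 2)) => [|j /negPf ji]; last first.
  by rewrite /F ji.
rewrite prodr_const cardC1 card_ord mulrCA; congr (_ * _).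
case: N i {F} => [[]//|N] i /=; rewrite exprS invfM -mulrA mulVf ?mulr1//.
Qed.

Lemma sum_sgn_of (R : pzRingType) N (A : {set 'I_N}) :
  \sum_(i < N) sgn_of R (i \in A) = 2 * #|A|%:R - N%:R.
Proof.
transitivity (\sum_(i < N) (2 * (i \in A)%:R - 1) : R).
  by apply: eq_bigr => i _; case: (i \in A); rewrite /= ?mulr1 ?mulr0 ?sub0r// -natr1 addrK.
rewrite big_split/= -mulr_sumr sumrN sumr_const card_ord -natr_sum.
by rewrite -big_mkcond/= sum1_card.
Qed.

(** A uniform subset [A] of ['I_N] supplies the independent signs, [X i] being [1] exactly when [i]
    is in [A]; their sum is [2 #|A| - N]. *)
Lemma distributed_as_walk_card (d : measure_display) (T : measurableType d)
    (R : realType) (P : probability T R) (N : nat) (S : {RV P >-> R}) :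
  (forall B : set R, measurable B -> P (S @^-1` B) =
    ((2 ^+ N)^-1 * \sum_(A : {set 'I_N}) ((2 * #|A|%:R - N%:R) \in B)%:R)%:E) ->
  distributed_as_walk N S.
Proof.
move=> SP; have [Q QE] := uniform_on_finType R (finset.set0 : {set 'I_N}).
have cN := card_set_ord R N.
pose dec w := nth (finset.set0 : {set 'I_N}) (enum {set 'I_N}) w.
have /choice[X XE] : forall i : 'I_N, exists X : {RV Q >-> R},
    X = (fun w => sgn_of R (i \in dec w)) :> (nat -> R).
  by move=> i; exact: nat_RV.
have QX i (B : set R) : Q (X i @^-1` B) = (((1 \in B)%:R + (-1 \in B)%:R) / 2)%:E.
  have -> : X i @^-1` B = [set w | [set A : {set 'I_N} | B (sgn_of R (i \in A))] (dec w)].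
    by rewrite XE.
  rewrite QE cN -(sum_set_coord i); congr (_ * _)%:E.
exists default_measure_display, nat, Q, X; split => [B mB|i|B mB].
- have -> : \bigcap_(i in [set: 'I_N]) X i @^-1` B i =
     [set w | [set A : {set 'I_N} | forall i, B i (sgn_of R (i \in A))] (dec w)].
    apply/seteqP; split => [w h i|w h i _]/=.
      by have := h i Logic.I; rewrite /= XE.
    by rewrite XE; exact: h.
  rewrite QE cN.
  rewrite [RHS](eq_bigr (fun i => (((1 \in B i)%:R + (-1 \in B i)%:R) / 2)%:E)); last first.
    by move=> i _; exact: QX.
  rewrite prodEFin big_split/= prodr_const card_ord -exprVn mulrC; congr (_ * _)%:E.
  pose F i b : R := (sgn_of R b \in B i)%:R.
  rewrite -[RHS](sum_set_prod F); apply: eq_bigr => A _.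
  have [h|h] := pselect (forall i, B i (sgn_of R (i \in A))).
    by rewrite mem_set// big1// => i _; rewrite /F mem_set.
  have /existsNP[i Bi] := h.
  by rewrite memNset// (bigD1 i)//= {1}/F memNset// mul0r.
- split; rewrite QX; congr (_%:E).
  + rewrite mem_set// memNset ?addr0 ?mul1r// => /= /eqP; lra.
  + rewrite memNset ?mem_set ?add0r ?mul1r// => /= /eqP; lra.
- rewrite SP//.
  have -> : [set w | B (\sum_(i < N) X i w)] =
      [set w | [set A : {set 'I_N} | B (2 * #|A|%:R - N%:R)] (dec w)].
    apply/seteqP; split => w /=; under eq_bigr do rewrite XE; by rewrite sum_sgn_of.
  by rewrite QE cN.
Qed.

Theorem theorem4 (R : realType) :
  exists n0 : nat, forall n : nat, (n0 <= n)%N -> ~~ odd n ->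
  exists (d : measure_display) (T : measurableType d) (P : probability T R)
    (S S' : {RV P >-> R}),
    [/\ distributed_as_walk n S,
        distributed_as_walk (4 * n) S' &
        {ae P, forall w,
          [/\ 0 <= S w * S' w,
              `|S' w| - (8 * n%:R)^-1 * `|S' w| ^+ 2 - 9 <= 2 * `|S w| &
              2 * `|S w| <= `|S' w| + 2]}].
Proof.
exists 200 => n n200 nodd.
have [M nE] : exists M, n = (2 * M)%N by exists n./2; rewrite mul2n even_halfK.
have M100 : (100 <= M)%N by lia.
have m0 : 100 <= M%:R :> R by rewrite ler_nat.
have -> : (4 * n = 2 * (4 * M))%N by lia.
rewrite {n}nE in n200 nodd *.
have [s sP] := walk_coupling R M100.
pose T : finType := ({set 'I_(2 * M)} * {set 'I_(2 * (4 * M))})%type.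
pose t0 : T := (finset.set0, finset.set0).
have [P PE] := uniform_on_finType R t0; pose dec w := nth t0 (enum T) w.
have [S SE] := nat_RV P (fun w => 2 * #|(dec w).1|%:R - (2 * M)%:R).
have [S' S'E] := nat_RV P (fun w => 2 * #|(s (dec w)).2|%:R - (2 * (4 * M))%:R).
have cT : #|T|%:R = 2 ^+ (2 * M) * 2 ^+ (2 * (4 * M)) :> R.
  by rewrite card_prod natrM !card_set_ord.
have p2 m : (2 : R) ^+ m != 0 by rewrite expf_neq0 ?pnatr_eq0.
exists default_measure_display, nat, P, S, S'; split.
- apply: distributed_as_walk_card => B _.
  have -> : S @^-1` B = [set w | [set x : T | B (2 * #|x.1|%:R - (2 * M)%:R)] (dec w)].
    by rewrite SE.
  rewrite PE cT.
  rewrite -(pair_bigA _ (fun (A : {set 'I_(2 * M)}) (A' : {set 'I_(2 * (4 * M))}) =>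
     (((A, A') : T) \in [set x : T | B (2 * #|x.1|%:R - (2 * M)%:R)])%:R))/=.
  rewrite (eq_bigr (fun A : {set 'I_(2 * M)} =>
     2 ^+ (2 * (4 * M)) * ((2 * #|A|%:R - (2 * M)%:R) \in B)%:R)) => [|A _]; last first.
    rewrite (eq_bigr (fun=> ((2 * #|A|%:R - (2 * M)%:R) \in B)%:R))//.
    by rewrite sumr_const_set.
  by rewrite -mulr_sumr invfM -mulrA mulKf.
- apply: distributed_as_walk_card => B _.
  have -> : S' @^-1` B =
      [set w | [set x : T | B (2 * #|(s x).2|%:R - (2 * (4 * M))%:R)] (dec w)].
    by rewrite S'E.
  rewrite PE cT.
  (* The permutation [s] preserves the uniform law. *)
  have -> : \sum_(x : T) (x \in [set x : T | B (2 * #|(s x).2|%:R - (2 * (4 * M))%:R)])%:R =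
      \sum_(x : T) (x \in [set x : T | B (2 * #|x.2|%:R - (2 * (4 * M))%:R)])%:R :> R.
    by rewrite [RHS](reindex_perm s).
  rewrite -(pair_bigA _ (fun (A : {set 'I_(2 * M)}) (A' : {set 'I_(2 * (4 * M))}) =>
     (((A, A') : T) \in [set x : T | B (2 * #|x.2|%:R - (2 * (4 * M))%:R)])%:R))/=.
  rewrite (eq_bigr (fun=> \sum_(A : {set 'I_(2 * (4 * M))})
     ((2 * #|A|%:R - (2 * (4 * M))%:R) \in B)%:R))//.
  rewrite sumr_const_set.
  by rewrite invfM [X in X * _]mulrC -mulrA mulKf.
(* Doubling [K] and [J] turns the constants [9/2] and [1] into [9] and [2]. *)
- apply: aeW => w; rewrite SE S'E.
  have := sP (dec w); set K := _%:R - M%:R; set J := _%:R - 4 * M%:R => -[h1 h2 h3].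
  have -> : 2 * #|(dec w).1|%:R - (2 * M)%:R = 2 * K :> R by rewrite /K natrM; ring.
  have -> : 2 * #|(s (dec w)).2|%:R - (2 * (4 * M))%:R = 2 * J :> R.
    by rewrite /J !natrM; ring.
  rewrite !normrM ger0_norm// natrM; split.
  + by nra.
  + have -> : (8 * (2 * M%:R))^-1 * (2 * `|J|) ^+ 2 = 2 * (`|J| ^+ 2 / (8 * M%:R)).
      by field; lra.
    by lra.
  + by lra.
Qed.
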